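(* Any noninterlaced minor of an $n\times n$ matrix $M$ is a positive rational function of the small central minors of $M$.
   Context: Indices $1,\dots,n$ of the rows and columns of an $n\times n$ matrix are regarded as arranged in cyclic order, and interpreted modulo $n$. Subsets $A,B\subset\{1,\dots,n\}$ are noninterlaced if they are contained in disjoint intervals of the cyclic order. A noninterlaced minor is $\det M_A^B=\det\big(M_{a_s,b_t}\big)_{s,t=1}^k$ for noninterlaced $A,B$ of the same cardinality $k$, with rows and columns ordered so that $a_1,\dots,a_k,b_k,\dots,b_1$ are in cyclic order, where $A=\{a_1,\dots,a_k\}$, $B=\{b_1,\dots,b_k\}$. The contiguous minor is $$\mathrm{CM}_{a,b,y}(M)=\det M_{a,a+1,\dots,a+y-1}^{\,b+y-1,\dots,b+1,b},$$ the determinant of the $y\times y$ submatrix with rows $a,a+1,\dots,a+y-1$ (in this order) and columns $b+y-1,\dots,b+1,b$ (in this order), indices modulo $n$. The central minor $\mathrm{CM}_{x,y}(M)$ ($x$ modulo $2n$, $0\le y\le n$) is $\mathrm{CM}_{a,b,y}(M)$ with $$a=\left\lfloor\frac{x-y}{2}\right\rfloor,\qquad b=\left\lfloor\frac{x-y+n-((n-1)\bmod 2)}{2}\right\rfloor .$$ The small central minors of $M$ are the $\mathrm{CM}_{x,y}(M)$ with $1\le x\le 2n$ and either $1\le y<n/2$, or $y=n/2$ and $x+y$ odd. A positive rational function is a quotient of two nonzero polynomials with nonnegative coefficients. The statement concerns generic matrices: it is an identity of rational functions in the matrix entries regarded as indeterminates (in particular it is valid whenever all small central minors are positive). *)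

(* Defs.v *)
From HB Require Import structures.
From mathcomp Require Import all_boot all_order all_algebra.
From mathcomp Require Import mpoly.
Set Implicit Arguments.
Unset Strict Implicit.
Unset Printing Implicit Defensive.
Import Order.TTheory GRing.Theory Num.Theory.
Local Open Scope ring_scope.

(* Row and column indices 1, ..., n are represented by their residues in
   'I_n = {0, ..., n-1}; the index n is thus the ordinal 0. The cyclic order
   is unaffected. *)

Lemma cyc_subproof (n : nat) (hn : (0 < n)%N) (z : int) :
  (`|(z %% n)%Z|%N < n)%N.
Proof.
by rewrite -ltz_nat gez0_abs ?modz_ge0 ?ltz_pmod // eqz_nat -lt0n.
Qed.

Definition cyc (n : nat) (hn : (0 < n)%N) (z : int) : 'I_n :=
  Ordinal (cyc_subproof hn z).

(* The interval a, a+1, ..., a+l-1 of the cyclic order; it is empty for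
   l = 0, and everything for l >= n. *)
Definition cyc_interval (n a l : nat) : {set 'I_n} :=
  [set i : 'I_n | [exists k : 'I_l, val i == ((a + k) %% n)%N]].

Definition noninterlaced (n : nat) (A B : {set 'I_n}) : Prop :=
  exists a l b m : nat,
    [/\ A \subset cyc_interval n a l, B \subset cyc_interval n b m
      & [disjoint cyc_interval n a l & cyc_interval n b m]].

(* s lists distinct indices while going around the cycle at most once, i.e.
   some rotation of s is strictly increasing. *)
Definition cyclically_ordered (n : nat) (s : seq 'I_n) : Prop :=
  exists r : nat, sorted ltn (rot r (map val s)).

Definition minor (S : comPzRingType) (n k : nat) (M : 'M[S]_n)
    (a b : k.-tuple 'I_n) : S :=
  \det (\matrix_(s < k, t < k) M (tnth a s) (tnth b t)).

Definition contiguous_minor (S : comPzRingType) (n : nat) (hn : (0 < n)%N)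
    (M : 'M[S]_n) (a b : int) (y : nat) : S :=
  \det (\matrix_(i < y, j < y)
          M (cyc hn (a + i%:Z)) (cyc hn (b + y%:Z - 1 - j%:Z))).

(* Division on int by 2 is the floor of the quotient, also for negative
   numerators. *)
Definition central_minor (S : comPzRingType) (n : nat) (hn : (0 < n)%N)
    (M : 'M[S]_n) (x : int) (y : nat) : S :=
  contiguous_minor hn M
    ((x - y%:Z) %/ 2)%Z
    ((x - y%:Z + n%:Z - ((n - 1) %% 2)%N%:Z) %/ 2)%Z
    y.

(* The index pairs (x, y) of the small central minors. *)
Definition small_idx (n : nat) : {set 'I_(2 * n).+1 * 'I_n.+1} :=
  [set xy : 'I_(2 * n).+1 * 'I_n.+1 |
    let x := val xy.1 in let y := val xy.2 in
    [&& (1 <= x)%N, (1 <= y)%N &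
        (2 * y < n)%N || ((2 * y == n)%N && odd (x + y))]].

Definition small_central_minors (S : comPzRingType) (n : nat) (hn : (0 < n)%N)
    (M : 'M[S]_n) : #|small_idx n|.-tuple S :=
  [tuple central_minor hn M (val (enum_val i).1)%:Z (val (enum_val i).2)
    | i < #|small_idx n|].

(* The n x n matrix of independent indeterminates. *)
Definition generic_mx (R : comNzRingType) (n : nat) :
    'M[{mpoly R[n * n]}]_n :=
  \matrix_(i < n, j < n) 'X_(mxvec_index i j).

Definition pos_mpoly (R : realFieldType) (k : nat) (P : {mpoly R[k]}) : Prop :=
  P != 0 /\ forall m : 'X_{1..k}, 0 <= P@_m.

(* f = P(v) / Q(v) as rational functions in N indeterminates. Division by 0
   being total in {fraction _}, Q(v) is required to be nonzero. *)
Definition positive_rational_function_of (R : realFieldType) (k N : nat)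
    (v : k.-tuple {mpoly R[N]}) (f : {fraction {mpoly R[N]}}) : Prop :=
  exists P Q : {mpoly R[k]},
    [/\ pos_mpoly P, pos_mpoly Q, comp_mpoly v Q != 0
      & f = tofrac (comp_mpoly v P) / tofrac (comp_mpoly v Q)].

(* Main.v *)
Require Import Defs.
From HB Require Import structures.
From mathcomp Require Import all_boot all_order all_algebra.
From mathcomp Require Import mpoly.
From mathcomp Require Import ring zify.

Set Implicit Arguments.
Unset Strict Implicit.
Unset Printing Implicit Defensive.
Import Order.TTheory GRing.Theory Num.Theory.
Local Open Scope ring_scope.

(** The quantities that are positive rational functions of the small central
minors are closed under sums, products and quotients by nonzero elements
([positive_rational_closed]), and a minor of the matrix of indeterminates in
distinct rows and distinct columns is not zero, since that matrix specializes
to a partial permutation matrix ([generic_det_neq0]). So it is enough to reach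
every noninterlaced minor from the small central ones by identities of the form
[x * y = z * t + u * v], all of whose terms are minors in distinct rows and
distinct columns; each such identity expresses [x] through the other five.

Contiguous minors. Write a contiguous minor as [CM(a, a + d, y)]; it is
noninterlaced when [y <= d] and [y + d <= n], and it is small central exactly
when moreover [y > 0] and [d] is [l] or [l + 1], where [l] is the integer part
of [(n - 1) / 2] ([central_contig_positive]). The Desnanot-Jacobi identity,
applied to contiguous minors, reads
  [CM(a, b + 1, y) CM(a + 1, b, y)
     = CM(a, b, y + 1) CM(a + 1, b + 1, y - 1) + CM(a, b, y) CM(a + 1, b + 1, y)]
and relates minors of level [d + 1] and [d - 1] on the left with minors of level
[d] on the right. It propagates positivity from the two central levels outwards
in both directions, and the constraints on [y] are preserved because [d >= n/2]
on the way up and [d <= n/2] on the way down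
([contig_minors_of_central]).

Arbitrary noninterlaced minors. Once the cycle is cut open, the rows of the
minor lie in an interval of length [p], its columns in the complementary
interval, of length [q = n - p]; the columns are listed backwards. This gives a
[p * q] rectangular table whose solid minors (consecutive rows, consecutive
columns) are noninterlaced contiguous minors. As in Fekete's criterion for total
positivity, every minor of such a table is obtained from the solid ones
([minors_of_solid_minors]): a three-term relation ([table_minor_skip]) replaces
a set of rows with a gap by sets of rows that are narrower or smaller, the
columns being an initial segment of a fixed list ([flag_minors]). Used for
consecutive columns, and after transposition for an arbitrary list of rows, it
gives all minors. *)

(** * Determinantal identities *)

Lemma det_mx22 (S : comNzRingType) (A : 'M[S]_2) :
  \det A = A 0 0 * A 1 1 - A 1 0 * A 0 1.
Proof.
rewrite (expand_det_col _ 0) !big_ord_recl big_ord0 addr0 /cofactor.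
rewrite !det_mx11 !mxE expr0 mul1r expr1 mulN1r mulrN.
have -> : lift 0 0 = 1 :> 'I_2 by apply: val_inj.
by have -> : lift 1 0 = 0 :> 'I_2 by apply: val_inj.
Qed.

(** Jacobi's formula for a 2 by 2 minor of the adjugate. The product of [A] with
the identity matrix whose first two columns are replaced by those of [\adj A] is
block triangular; comparing determinants gives the formula multiplied by
[\det A]. The factor is cancelled for ['X - (- A)], whose determinant is monic,
and the formula for [A] follows by setting ['X] to 0. *)
Lemma det_mul_det_drsubmx (S : comNzRingType) (m : nat) (A : 'M[S]_(2 + m)) :
  \det A * \det (drsubmx A) =
  cofactor A 0 0 * cofactor A 1 1 - cofactor A 0 1 * cofactor A 1 0.
Proof.
have cancellable (T : comNzRingType) (B : 'M[T]_(2 + m)) :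
    \det B * (\det B * \det (drsubmx B)) =
    \det B * (cofactor B 0 0 * cofactor B 1 1 -
              cofactor B 0 1 * cofactor B 1 0).
  pose P := \adj B.
  have defBP : B *m block_mx (ulsubmx P) 0 (dlsubmx P) 1%:M =
               block_mx (\det B)%:M (ursubmx B) 0 (drsubmx B).
    have := mul_mx_adj B; rewrite -/P -{1}[B]submxK -{1}[P]submxK.
    rewrite mulmx_block scalar_mx_block => /eq_block_mx[ul _ dl _].
    by rewrite -{1}[B]submxK mulmx_block ul dl !mulmx0 !mulmx1 !add0r.
  have := congr1 determinant defBP.
  rewrite det_mulmx det_lblock det_ublock det1 mulr1 det_scalar mulrA -expr2.
  move=> <-; congr (_ * _).
  rewrite det_mx22 !mxE.
  have -> : lshift m (0 : 'I_2) = 0 :> 'I_(2 + m) by apply: val_inj.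
  have -> : lshift m (1 : 'I_2) = 1 :> 'I_(2 + m) by apply: val_inj.
  by congr (_ - _); rewrite mulrC.
pose X0 : {rmorphism {poly S} -> S} := horner_eval (0 : S).
pose B := char_poly_mx (- A).
have lreg_detB : GRing.lreg (\det B).
  have := char_poly_monic (- A); rewrite /char_poly -/B => monB.
  by move=> u v /(monic_lreg monB).
have B0 : map_mx X0 B = A.
  apply/matrixP=> i j; rewrite !mxE /= /horner_eval !hornerE /=.
  by rewrite hornerMn hornerX mul0rn add0r opprK.
have X0det : X0 (\det B) = \det A by rewrite -det_map_mx B0.
have X0dr : X0 (\det (drsubmx B)) = \det (drsubmx A).
  by rewrite -det_map_mx map_drsubmx B0.
have X0cof i j : X0 (cofactor B i j) = cofactor A i j.
  by rewrite -cofactor_map_mx B0.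
rewrite -X0det -X0dr -!X0cof -!(rmorphM X0) -(rmorphB X0).
by congr (X0 _); apply: lreg_detB; exact: cancellable.
Qed.

(** Minors of an infinite table [A], in the rows [f 0, ..., f k.-1] and the
columns [g 0, ..., g k.-1]. Deleting the first row is composing [f] with [S],
deleting the row [e] is composing it with [bump e], and deleting the last row
is lowering [k], so that submatrices need no casts between ordinal types. *)
Definition table_minor (T : comNzRingType) (A : nat -> nat -> T) (k : nat)
    (f g : nat -> nat) : T :=
  \det (\matrix_(i < k, j < k) A (f i) (g j)).

Lemma eq_table_minor (T : comNzRingType) (A A' : nat -> nat -> T) (k : nat)
    (f f' g g' : nat -> nat) :
  (forall i j, (i < k)%N -> (j < k)%N -> A (f i) (g j) = A' (f' i) (g' j)) ->
  table_minor A k f g = table_minor A' k f' g'.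
Proof.
by move=> eqA; congr (\det _); apply/matrixP=> i j; rewrite !mxE eqA.
Qed.

Lemma table_minor_tr (T : comNzRingType) (A : nat -> nat -> T) k f g :
  table_minor A k f g = table_minor (fun i j => A j i) k g f.
Proof.
by rewrite /table_minor -det_tr; congr (\det _); apply/matrixP=> i j; rewrite !mxE.
Qed.

(** The Laplace expansions along the row that moves have the same terms up to sign. *)
Lemma table_minor_move_row (T : comNzRingType) (A : nat -> nat -> T) k e f g :
  (e <= k)%N ->
  table_minor A k.+1 f g =
  (-1) ^+ e *
  table_minor A k.+1 (fun i => if i is i'.+1 then f (bump e i') else f e) g.
Proof.
move=> le_ek; have lt_ek : (e < k.+1)%N by [].
rewrite /table_minor (expand_det_row _ (Ordinal lt_ek)) [in RHS](expand_det_row _ 0).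
rewrite big_distrr; apply: eq_bigr => j _ /=.
rewrite !mxE [RHS]mulrCA; congr (_ * _); rewrite /cofactor exprD -mulrA.
congr (_ * (_ * \det _)).
by apply/matrixP=> i l; rewrite !mxE.
Qed.

(** The reordering 0, m+1, 1, ..., m of the indices 0, ..., m+1, which brings the
two extreme rows into the leading block of [det_mul_det_drsubmx]. *)
Definition ends_first (m i : nat) : nat :=
  match i with 0 => 0 | 1 => m.+1 | i'.+2 => i'.+1 end.

Lemma table_minor_ends_first (T : comNzRingType) (A : nat -> nat -> T) m f g :
  table_minor A m.+2 (f \o ends_first m) g = (-1) ^+ m * table_minor A m.+2 f g.
Proof.
(* Both sides become equal once the last row is moved to the top. *)
rewrite (@table_minor_move_row _ _ _ 1) //.
rewrite (@table_minor_move_row _ A m.+1 m.+1 f) //.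
rewrite [RHS]mulrA -exprD addnS [in RHS]exprS exprD -expr2 sqrr_sign mulr1 expr1.
congr (_ * _); apply: eq_table_minor => -[|[|i]] j lt_i _ //=.
by have -> : bump m.+1 i.+1 = i.+1 by rewrite /bump; lia.
Qed.

Lemma table_minor_last_first (T : comNzRingType) (A : nat -> nat -> T) m f g :
  table_minor A m.+1 (f \o ends_first m \o S) g =
  (-1) ^+ m * table_minor A m.+1 (f \o S) g.
Proof.
rewrite [in RHS](@table_minor_move_row _ _ _ m) // mulrA -expr2 sqrr_sign mul1r.
apply: eq_table_minor => -[|i] j lt_i _ //=.
by have -> : bump m i = i by rewrite /bump; lia.
Qed.

(** Jacobi's formula with the first and last rows and columns in the distinguished
positions. Both reorderings have sign [(-1) ^+ m], and each product of two
minors collects an even number of these signs. *)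
Lemma desnanot_jacobi (T : comNzRingType) (A : nat -> nat -> T) m f g :
  table_minor A m.+2 f g * table_minor A m (f \o S) (g \o S) =
  table_minor A m.+1 f g * table_minor A m.+1 (f \o S) (g \o S)
  - table_minor A m.+1 f (g \o S) * table_minor A m.+1 (f \o S) g.
Proof.
pose B : 'M[T]_(2 + m) :=
  \matrix_(i, j) A (f (ends_first m i)) (g (ends_first m j)).
have detB : \det B = table_minor A m.+2 f g.
  rewrite -/(table_minor A m.+2 (f \o ends_first m) (g \o ends_first m)).
  rewrite table_minor_ends_first [in LHS]table_minor_tr table_minor_ends_first.
  by rewrite mulrA -expr2 sqrr_sign mul1r -table_minor_tr.
have := det_mul_det_drsubmx B; rewrite detB.
have -> : \det (drsubmx B) = table_minor A m (f \o S) (g \o S).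
  by congr (\det _); apply/matrixP=> i j; rewrite !mxE.
have -> : cofactor B 0 0 = table_minor A m.+1 (f \o S) (g \o S).
  rewrite /cofactor expr0 mul1r.
  transitivity (table_minor A m.+1 (f \o ends_first m \o S)
                                   (g \o ends_first m \o S)).
    by congr (\det _); apply/matrixP=> i j; rewrite !mxE.
  rewrite table_minor_last_first table_minor_tr table_minor_last_first.
  by rewrite mulrA -expr2 sqrr_sign mul1r -table_minor_tr.
have low i : (i < m.+1)%N -> ends_first m (bump 1 i) = i by case: i.
have -> : cofactor B 1 1 = table_minor A m.+1 f g.
  rewrite /cofactor -signr_odd expr0 mul1r.
  by congr (\det _); apply/matrixP=> i j; rewrite !mxE /= !low.
have -> : cofactor B 0 1 = (-1) ^+ m.+1 * table_minor A m.+1 (f \o S) g.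
  rewrite /cofactor add0n expr1 exprS -mulrA -table_minor_last_first.
  by congr (_ * \det _); apply/matrixP=> i j; rewrite !mxE /= !low.
have -> : cofactor B 1 0 = (-1) ^+ m.+1 * table_minor A m.+1 f (g \o S).
  rewrite /cofactor addn0 expr1 exprS -mulrA [in RHS]table_minor_tr.
  rewrite -table_minor_last_first -table_minor_tr.
  by congr (_ * \det _); apply/matrixP=> i j; rewrite !mxE /= !low.
move=> ->; rewrite mulrACA -expr2 sqrr_sign mul1r; congr (_ - _); exact: mulrC.
Qed.

(** A three-term Pluecker relation between minors of a table with [m.+2] rows and
[m.+1] columns. It is the Desnanot-Jacobi identity for the square table obtained by
putting in front of the columns [h] the indicator column of the interior row
[e.+1]: the minors using that column are, up to sign, minors of [A] without
the row [e.+1], and the signs agree. *)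
Lemma table_minor_skip (T : comNzRingType) (A : nat -> nat -> T) m e g h :
  (e < m)%N ->
  table_minor A m.+1 (g \o bump e.+1) h * table_minor A m (g \o S) h =
  table_minor A m.+1 (g \o S) h * table_minor A m (g \o bump e.+1) h
  + table_minor A m (g \o S \o bump e) h * table_minor A m.+1 g h.
Proof.
move=> lt_em.
pose A' i j := if j is j'.+1 then A (g i) (h j') else (i == e.+1)%:R.
have expand k r f : (r <= k)%N -> f r = e.+1 ->
    (forall i, (i < k)%N -> f (bump r i) != e.+1) ->
    table_minor A' k.+1 f id = (-1) ^+ r * table_minor A k (g \o f \o bump r) h.
  move=> le_rk fr f_other; rewrite (table_minor_move_row _ _ _ le_rk); congr (_ * _).
  rewrite /table_minor (expand_det_col _ 0) big_ord_recl big1 ?addr0; last first.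
    by move=> i _; rewrite !mxE /= (negPf (f_other _ (ltn_ord i))) mul0r.
  rewrite !mxE /= fr eqxx mul1r /cofactor expr0 mul1r.
  by congr (\det _); apply/matrixP=> i j; rewrite !mxE.
have := desnanot_jacobi A' m id id.
rewrite (expand m.+1 e.+1) //; last 2 first.
- by rewrite ltnS ltnW.
- by move=> i _; rewrite eq_sym neq_bump.
rewrite (expand m e.+1) //; last first.
  by move=> i _; rewrite eq_sym neq_bump.
rewrite (expand m e) //; last 2 first.
- exact: ltnW.
- by move=> i _; rewrite eqSS eq_sym neq_bump.
have shiftE k f : table_minor A' k f (id \o S) = table_minor A k (g \o f) h.
  by apply: eq_table_minor.
rewrite !shiftE -![g \o id \o _]/(g \o _) => D.
apply: (can_inj (signrMK e.+1)).
rewrite mulrA D mulrDr.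
rewrite exprS; ring.
Qed.

(** * All minors from the solid ones *)

(** Division is required for every nonzero divisor in the class; this is how
minors with distinct rows and columns become admissible denominators. *)
Definition subtraction_free_closed (F : fieldType) (P : F -> Prop) : Prop :=
  [/\ P 1, forall x y, P x -> P y -> P (x + y),
      forall x y, P x -> P y -> P (x * y)
    & forall x y, P x -> P y -> y != 0 -> P (x / y)].

Definition increasing_into (k p : nat) (f : nat -> nat) : Prop :=
  {in gtn k &, {homo f : i j / (i < j)%N}} /\ forall i, (i < k)%N -> (f i < p)%N.

Lemma increasing_into_inj (k p : nat) (f : nat -> nat) (i j : 'I_k) :
  increasing_into k p f -> f i = f j -> i = j.
Proof.
move=> [incr_f _] eq_f; apply: val_inj; case: (ltngtP i j) => // lt_ij.
  by have := incr_f _ _ (ltn_ord i) (ltn_ord j) lt_ij; rewrite eq_f ltnn.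
by have := incr_f _ _ (ltn_ord j) (ltn_ord i) lt_ij; rewrite eq_f ltnn.
Qed.

(** The minors meeting the first columns of [A] are reached from those with
consecutive rows, by induction on the number of rows and then on the width
[f m - f 0]. If [e.+1] is the first position where [f] skips a value, let [g]
be [f] with the missing value inserted there. In [table_minor_skip] for [g],
the minor wanted is multiplied by a nonzero smaller one, and every other factor
is either smaller or misses one end of the range of [f]. *)
Lemma flag_minors (F : fieldType) (P : F -> Prop) (A : nat -> nat -> F) (p K : nat) :
  subtraction_free_closed P ->
  (forall k f, (k <= K)%N -> increasing_into k p f -> table_minor A k f id != 0) ->
  (forall k i, (k <= K)%N -> (i + k <= p)%N -> P (table_minor A k (addn i) id)) ->
  forall k f, (k <= K)%N -> increasing_into k p f -> P (table_minor A k f id).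
Proof.
move=> [P1 PD PM PV] nz solid; elim=> [|m IHm] f.
  by move=> _ _; rewrite /table_minor det_mx00.
move=> le_mK; have [w] := ubnP (f m - f 0)%N; elim: w f => // w IHw f.
rewrite ltnS => width_f [incr_f lt_fp].
have f_ge i : (i <= m)%N -> (f 0 + i <= f i)%N.
  elim: i => [|i IHi] lt_im; first by rewrite addn0.
  by rewrite addnS (leq_ltn_trans (IHi (ltnW lt_im))) // incr_f ?inE // ltnS ltnW.
have [/forallP/= contig | ] := boolP [forall i : 'I_m.+1, f i == f 0 + i]%N.
  have -> : table_minor A m.+1 f id = table_minor A m.+1 (addn (f 0)) id.
    by apply: eq_table_minor => i j lt_im _; rewrite (eqP (contig (Ordinal lt_im))).
  by apply: solid => //; rewrite addnS -(eqP (contig ord_max)) lt_fp.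
rewrite negb_forall => /existsP[/= e0 gap_e0].
have ex_gap : exists e, (e <= m)%N && (f e != f 0 + e)%N.
  by exists e0; rewrite -ltnS ltn_ord.
have [e' /andP[le_em gap_e] min_e] := ex_minnP ex_gap.
have f_low i : (i < e')%N -> f i = (f 0 + i)%N.
  move=> lt_ie; apply/eqP/negPn/negP=> gap_i.
  have le_im : (i <= m)%N := leq_trans (ltnW lt_ie) le_em.
  by have := min_e i; rewrite gap_i le_im leqNgt lt_ie => /(_ isT).
case: e' => [|e] in le_em gap_e min_e f_low *; first by rewrite addn0 eqxx in gap_e.
pose g i := if (i <= e.+1)%N then (f 0 + i)%N else f i.-1.
have gap_lt : (f 0 + e.+1 < f e.+1)%N by rewrite ltn_neqAle eq_sym gap_e f_ge.
have g_bump i : g (bump e.+1 i) = f i.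
  rewrite /g /bump; case: (leqP e.+1 i) => [lt_ei | lt_ie].
    by rewrite add1n ltnNge lt_ei.
  by rewrite add0n (ltnW lt_ie) (f_low i).
have g_incr : increasing_into m.+2 p g.
  split=> [i j | i]; rewrite ?inE => lt_i.
    move=> lt_j lt_ij; rewrite /g.
    have [le_je | lt_ej] := leqP j e.+1.
      by rewrite (leq_trans (ltnW lt_ij)) // ltn_add2l.
    have [le_ie | lt_ei] := leqP i e.+1.
      have [-> | ne_j] := eqVneq j e.+2.
        by rewrite (leq_ltn_trans _ gap_lt) // leq_add2l.
      have lt_f : (f e.+1 < f j.-1)%N by apply: incr_f; rewrite ?inE; lia.
      by rewrite (leq_ltn_trans _ (ltn_trans gap_lt lt_f)) // leq_add2l.
    by apply: incr_f; rewrite ?inE; lia.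
  rewrite /g; case: (leqP i e.+1) => [le_ie | lt_ei]; last by apply: lt_fp; lia.
  have lt_ep := leq_ltn_trans (ltnW gap_lt) (lt_fp e.+1 le_em).
  by rewrite (leq_ltn_trans _ lt_ep) // leq_add2l.
have sub_incr k h : (forall i j, (i < j < k)%N -> (h i < h j)%N) ->
    (forall i, (i < k)%N -> (h i < m.+2)%N) -> increasing_into k p (g \o h).
  move=> incr_h lt_h; split=> [i j | i] lt_i.
    move=> lt_j lt_ij; apply: (proj1 g_incr); rewrite ?inE ?lt_h //.
    by rewrite incr_h // lt_ij.
  by apply: (proj2 g_incr); apply: lt_h.
have incrS k : (k <= m.+1)%N -> increasing_into k p (g \o S).
  by move=> le_k; apply: sub_incr => // i j; lia.
have plucker := table_minor_skip A g id le_em.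
have neS : table_minor A m (g \o S) id != 0 by apply: nz (ltnW le_mK) (incrS _ _).
have -> : table_minor A m.+1 f id = table_minor A m.+1 (g \o bump e.+1) id.
  by apply: eq_table_minor => i j _ _ /=; rewrite g_bump.
rewrite -[X in P X](mulfK neS) plucker; apply: PV => //; last first.
  by apply: IHm (ltnW le_mK) (incrS _ _).
apply: PD; apply: PM.
- apply: IHw; last exact: incrS.
  by rewrite /g /=; have := f_ge m (leqnn m); case: ifP => ?; lia.
- apply: IHm; [exact: ltnW|].
  apply: sub_incr => [i j|i]; rewrite /bump; lia.
- apply: IHm; [exact: ltnW|].
  apply: (@sub_incr m (S \o bump e)) => [i j|i]; rewrite /bump /=; lia.
- apply: IHw; last first.
    split=> [i j ? ?|i ?]; [apply: (proj1 g_incr) | apply: (proj2 g_incr)];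
      by rewrite ?inE; exact: ltnW.
  rewrite /g /= addn0; case: (leqP m e.+1) => [le_me | lt_em].
    have eq_m : m = e.+1 by lia.
    move: width_f; rewrite eq_m; lia.
  by have := incr_f m.-1 m; rewrite !inE; have := f_ge m (leqnn m); lia.
Qed.

(** Fekete's argument: [flag_minors] is applied to each block of consecutive
columns, and the outcome provides the hypothesis of [flag_minors] for the
transposed table restricted to an arbitrary list of rows. *)
Lemma minors_of_solid_minors (F : fieldType) (P : F -> Prop)
    (A : nat -> nat -> F) (p q : nat) :
  subtraction_free_closed P ->
  (forall k f g, increasing_into k p f -> increasing_into k q g ->
     table_minor A k f g != 0) ->
  (forall k i j, (i + k <= p)%N -> (j + k <= q)%N ->
     P (table_minor A k (addn i) (addn j))) ->
  forall k f g, increasing_into k p f -> increasing_into k q g ->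
  P (table_minor A k f g).
Proof.
move=> closedP nz solid k f g inc_f inc_g.
have shorter k1 p1 h : (k1 <= k)%N -> increasing_into k p1 h ->
    increasing_into k1 p1 h.
  move=> le_k1 [incr_h lt_h]; split=> [x y|x] lt_x; last first.
    by apply: lt_h; exact: leq_trans le_k1.
  by move=> lt_y; apply: incr_h; apply: leq_trans le_k1.
have solid_cols k1 j h : (j + k1 <= q)%N -> increasing_into k1 p h ->
    P (table_minor A k1 h (addn j)).
  move=> le_jq; pose Aj x y := A x (j + y)%N.
  apply: (@flag_minors _ P Aj p (q - j)) => //
    [k2 h2 le_k2 inc_h2 | k2 i le_k2 le_ip |].
  - apply: (nz k2 h2 (addn j)) => //; split=> [x y _ _|x lt_x]; last by lia.
    by rewrite ltn_add2l.
  - by apply: (solid k2 i j) => //; lia.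
  - by lia.
pose Af y x := A (f x) y.
rewrite table_minor_tr; apply: (@flag_minors _ P Af q k) => //
  [k1 h le_k1 inc_h | k1 i le_k1 le_iq].
  by rewrite table_minor_tr; apply: (nz k1 f h) => //; exact: shorter inc_f.
by rewrite table_minor_tr; apply: (solid_cols k1 i f) => //; exact: shorter inc_f.
Qed.

(** * Contiguous minors from the central ones *)

(** The contiguous minors of a cyclic matrix, written on its lift to a table
indexed by all pairs of integers. *)
Definition contig (T : comNzRingType) (N : int -> int -> T)
    (a b : int) (y : nat) : T :=
  \det (\matrix_(i < y, j < y) N (a + i%:Z) (b + y%:Z - 1 - j%:Z)).

Lemma contig_desnanot_jacobi (T : comNzRingType) (N : int -> int -> T) a b m :
  contig N a b m.+2 * contig N (a + 1) (b + 1) m =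
  contig N a (b + 1) m.+1 * contig N (a + 1) b m.+1
  - contig N a b m.+1 * contig N (a + 1) (b + 1) m.+1.
Proof.
pose A (i j : nat) := N (a + i%:Z) (b + m.+2%:Z - 1 - j%:Z).
have windowE k i j a' b' : a' = a + i%:Z -> b' + k%:Z + j%:Z = b + m.+2%:Z ->
    contig N a' b' k = table_minor A k (addn i) (addn j).
  move=> -> eq_b; congr (\det _); apply/matrixP=> x y; rewrite !mxE /A.
  by congr (N _ _); rewrite PoszD; [rewrite addrA | lia].
have -> : contig N a b m.+2 = table_minor A m.+2 id id.
  by apply: (windowE _ 0%N 0%N); lia.
have -> : contig N (a + 1) (b + 1) m = table_minor A m (id \o S) (id \o S).
  by apply: (windowE _ 1%N 1%N); lia.
have -> : contig N a (b + 1) m.+1 = table_minor A m.+1 id id.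
  by apply: (windowE _ 0%N 0%N); lia.
have -> : contig N (a + 1) b m.+1 = table_minor A m.+1 (id \o S) (id \o S).
  by apply: (windowE _ 1%N 1%N); lia.
have -> : contig N a b m.+1 = table_minor A m.+1 id (id \o S).
  by apply: (windowE _ 0%N 1%N); lia.
have -> : contig N (a + 1) (b + 1) m.+1 = table_minor A m.+1 (id \o S) id.
  by apply: (windowE _ 1%N 0%N); lia.
exact: desnanot_jacobi.
Qed.

(** The level of [contig N a b y] is [b - a]. The Desnanot-Jacobi identity joins
three consecutive levels, and is solved for the upper one above the central
levels [l] and [l.+1], for the lower one below them. To reach size [m.+1] one
needs size [m.+2] at the middle level [d], that is, [m.+2 <= d] and
[m.+2 + d <= n]. The second condition is the one assumed at the level [d.+1] to
be reached and implies the first when [n <= 2 * d]; the first is the one assumed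
at the level [d.-1] and implies the second when [2 * d <= n]. *)
Lemma contig_minors_of_central (F : fieldType) (P : F -> Prop)
    (N : int -> int -> F) (n l : nat) :
  subtraction_free_closed P ->
  (2 * l < n <= 2 * l.+1)%N ->
  (forall a b y, (y <= n)%N -> contig N a b y != 0) ->
  (forall a d y, (l <= d <= l.+1)%N -> (y <= d)%N -> (y + d <= n)%N ->
     P (contig N a (a + d%:Z) y)) ->
  forall a d y, (y <= d)%N -> (y + d <= n)%N -> P (contig N a (a + d%:Z) y).
Proof.
move=> [P1 PD PM PV] /andP[lt_ln le_nl] nz central.
pose level d := forall a y, (y <= d)%N -> (y + d <= n)%N ->
  P (contig N a (a + d%:Z) y).
have contig0 a b : P (contig N a b 0) by rewrite /contig det_mx00.
have octahedron a b m :
    contig N a (b + 1) m.+1 * contig N (a + 1) b m.+1 =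
    contig N a b m.+2 * contig N (a + 1) (b + 1) m
    + contig N a b m.+1 * contig N (a + 1) (b + 1) m.+1.
  by rewrite contig_desnanot_jacobi subrK.
have level_at d a b y : level d -> b = a + d%:Z -> (y <= d)%N -> (y + d <= n)%N ->
    P (contig N a b y).
  by move=> lev_d ->; exact: lev_d.
have up d : (n <= 2 * d.+1)%N -> level d -> level d.+1 -> level d.+2.
  move=> le_nd lev0 lev1 a [|m] le_md le_dn; first exact: contig0.
  have nz1 : contig N (a + 1) (a + d.+1%:Z) m.+1 != 0 by apply: nz; lia.
  have -> : a + d.+2%:Z = a + d.+1%:Z + 1 by lia.
  rewrite -[X in P X](mulfK nz1) octahedron; apply: PV => //; last first.
    by apply: (level_at d) => //; lia.
  by apply: PD; apply: PM; apply: (level_at d.+1) => //; lia.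
have down d : (2 * d.+1 <= n)%N -> level d.+1 -> level d.+2 -> level d.
  move=> le_dn lev1 lev2 a [|m] le_md le_mn; first exact: contig0.
  have nz1 : contig N (a - 1) (a + d%:Z + 1) m.+1 != 0 by apply: nz; lia.
  have := octahedron (a - 1) (a + d%:Z) m; rewrite subrK mulrC => oct.
  rewrite -[X in P X](mulfK nz1) oct; apply: PV => //; last first.
    by apply: (level_at d.+2) => //; lia.
  by apply: PD; apply: PM; apply: (level_at d.+1) => //; lia.
have above j : level (l + j)%N /\ level (l + j).+1.
  elim: j => [|j [lev0 lev1]].
    by rewrite addn0; split=> a y; apply: central; rewrite leqnn leqnSn.
  by rewrite addnS; split=> //; apply: up => //; lia.
have below j : (j <= l)%N -> level (l - j)%N /\ level (l - j).+1.
  elim: j => [|j IHj] le_jl.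
    by rewrite subn0; have := above 0%N; rewrite addn0.
  have [] := IHj (ltnW le_jl).
  have -> : (l - j = (l - j.+1).+1)%N by lia.
  by move=> lev1 lev2; split=> //; apply: down => //; lia.
move=> a d y; suff: level d by apply.
have [le_ld | lt_dl] := leqP l d.
  by have [] := above (d - l)%N; rewrite subnKC.
by have [] := below (l - d)%N (leq_subr _ _); rewrite subKn // ltnW.
Qed.

(** * Positive rational functions *)

Lemma pos_mpoly1 (R : realFieldType) (k : nat) : pos_mpoly (1 : {mpoly R[k]}).
Proof. by split=> [|m]; rewrite ?oner_neq0 // mcoeff1 ler0n. Qed.

(** Nonnegative coefficients cannot cancel in a sum, so it stays nonzero. *)
Lemma pos_mpolyD (R : realFieldType) (k : nat) (P Q : {mpoly R[k]}) :
  pos_mpoly P -> pos_mpoly Q -> pos_mpoly (P + Q).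
Proof.
move=> [nzP geP] [_ geQ]; split=> [|m]; last by rewrite mcoeffD addr_ge0.
apply: contra nzP => /eqP PQ0; apply/eqP/mpolyP=> m; rewrite mcoeff0.
have /eqP := congr1 (mcoeff m) PQ0; rewrite mcoeffD mcoeff0.
by rewrite paddr_eq0 // => /andP[/eqP].
Qed.

Lemma pos_mpolyM (R : realFieldType) (k : nat) (P Q : {mpoly R[k]}) :
  pos_mpoly P -> pos_mpoly Q -> pos_mpoly (P * Q).
Proof.
move=> [nzP geP] [nzQ geQ]; split=> [|m]; first by rewrite mulf_neq0.
by rewrite mcoeffM sumr_ge0 // => h _; rewrite mulr_ge0.
Qed.

(** Quotients of the values of a semiring of elements under a ring morphism [ev]
can be added and multiplied by the usual rules. The reciprocal of a quotient is
again one as soon as the numerator has a nonzero value. *)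
Lemma quotients_closed (T : comNzRingType) (F : fieldType)
    (ev : {rmorphism T -> F}) (pos : T -> Prop) :
  pos 1 -> (forall P Q, pos P -> pos Q -> pos (P + Q)) ->
  (forall P Q, pos P -> pos Q -> pos (P * Q)) ->
  subtraction_free_closed (fun f =>
    exists P Q, [/\ pos P, pos Q, ev Q != 0 & f = ev P / ev Q]).
Proof.
move=> pos1 posD posM; split.
- by exists 1, 1; rewrite rmorph1 divr1 oner_neq0.
- move=> _ _ [P1 [Q1 [pP1 pQ1 nz1 ->]]] [P2 [Q2 [pP2 pQ2 nz2 ->]]].
  exists (P1 * Q2 + P2 * Q1), (Q1 * Q2).
  rewrite rmorphD !rmorphM mulf_neq0 ?addf_div //.
  by split; auto.
- move=> _ _ [P1 [Q1 [pP1 pQ1 nz1 ->]]] [P2 [Q2 [pP2 pQ2 nz2 ->]]].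
  exists (P1 * P2), (Q1 * Q2).
  by rewrite !rmorphM mulf_neq0 ?mulf_div //; split; auto.
- move=> _ _ [P1 [Q1 [pP1 pQ1 nz1 ->]]] [P2 [Q2 [pP2 pQ2 nz2 ->]]].
  rewrite mulf_eq0 negb_or => /andP[nzP2 _].
  exists (P1 * Q2), (Q1 * P2).
  by rewrite !rmorphM mulf_neq0 ?invf_div ?mulf_div //; split; auto.
Qed.

Lemma positive_rational_closed (R : realFieldType) (k N : nat)
    (v : k.-tuple {mpoly R[N]}) :
  subtraction_free_closed (positive_rational_function_of v).
Proof.
pose ev : {rmorphism {mpoly R[k]} -> {fraction {mpoly R[N]}}} :=
  @tofrac _ \o comp_mpoly v.
have [C1 CD CM CV] := @quotients_closed _ _ ev _
  (pos_mpoly1 R k) (@pos_mpolyD R k) (@pos_mpolyM R k).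
have iffP f : positive_rational_function_of v f <->
    exists P Q, [/\ pos_mpoly P, pos_mpoly Q, ev Q != 0 & f = ev P / ev Q].
  split=> -[P [Q [pP pQ nzQ ->]]]; exists P, Q; first by rewrite tofrac_eq0.
  by rewrite tofrac_eq0 in nzQ.
split.
- exact/iffP.
- by move=> x y /iffP Px /iffP Py; apply/iffP; apply: CD.
- by move=> x y /iffP Px /iffP Py; apply/iffP; apply: CM.
- by move=> x y /iffP Px /iffP Py nz_y; apply/iffP; apply: CV.
Qed.

Lemma positive_rational_var (R : realFieldType) (k N : nat)
    (v : k.-tuple {mpoly R[N]}) (i : 'I_k) :
  positive_rational_function_of v (tofrac (tnth v i)).
Proof.
exists 'X_i, 1; split; last by rewrite comp_mpolyXU rmorph1 tofrac1 divr1 -tnth_nth.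
- split=> [|m]; last by rewrite mcoeffX ler0n.
  apply/eqP=> /(congr1 (mcoeff U_(i))); rewrite mcoeffXU mcoeff0 eqxx.
  by move/eqP; rewrite oner_eq0.
- exact: pos_mpoly1.
- by rewrite rmorph1 oner_neq0.
Qed.

(** * Minors of the generic matrix *)

(** Setting to 1 the indeterminates at the positions [(r i, c i)], and the others
to 0, turns the submatrix into the identity. *)
Lemma generic_det_neq0 (R : realFieldType) (n k : nat) (r c : 'I_k -> 'I_n) :
  injective r -> injective c ->
  \det (\matrix_(i < k, j < k) generic_mx R n (r i) (c j)) != 0.
Proof.
move=> inj_r inj_c.
pose E : 'M[R]_n := \matrix_(x, y) [exists i, (r i == x) && (c i == y)]%:R.
pose ev : {rmorphism {mpoly R[n * n]} -> R} := meval (fun x => mxvec E 0 x).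
apply/eqP=> /(congr1 ev); rewrite -det_map_mx [RHS]rmorph0.
have -> : map_mx ev (\matrix_(i, j) generic_mx R n (r i) (c j)) = 1%:M.
  apply/matrixP=> i j; rewrite !mxE [LHS]mevalXU mxvecE mxE.
  congr (_ %:R); congr nat_of_bool.
  apply/existsP/eqP=> [[x /andP[/eqP/inj_r <- /eqP/inj_c <-]] // | ->].
  by exists j; rewrite !eqxx.
by rewrite det1 => /eqP; rewrite oner_eq0.
Qed.

Lemma cyc_nat (n : nat) (hn : (0 < n)%N) (z : nat) (i : 'I_n) :
  z = i %[mod n] -> cyc hn z%:Z = i.
Proof.
by move=> eq_z; apply: val_inj; rewrite /= modz_nat eq_z modn_small.
Qed.

Lemma cyc_near_inj (n : nat) (hn : (0 < n)%N) (x y : int) :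
  (`|x - y| < n)%N -> cyc hn x = cyc hn y -> x = y.
Proof.
move=> near /(congr1 val) /= eq_xy.
have /eqP : (x = y %[mod n])%Z.
  have n0 : n%:Z != 0 by lia.
  by have := modz_ge0 x n0; have := modz_ge0 y n0; lia.
rewrite eqz_mod_dvd => /dvdzP[q eq_q]; suff : q = 0 by lia.
nia.
Qed.

Lemma cyc_periodic (n : nat) (hn : (0 < n)%N) (z q : int) :
  cyc hn (z + q * n%:Z) = cyc hn z.
Proof. by apply: val_inj; rewrite /= addrC modzMDl. Qed.

Definition generic_entry (R : realFieldType) (n : nat) (hn : (0 < n)%N)
    (i j : int) : {fraction {mpoly R[n * n]}} :=
  tofrac (generic_mx R n (cyc hn i) (cyc hn j)).

Lemma generic_entry_det (R : realFieldType) (n : nat) (hn : (0 < n)%N) (k : nat)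
    (r c : 'I_k -> int) :
  \det (\matrix_(i < k, j < k) generic_entry R hn (r i) (c j)) =
  tofrac (\det (\matrix_(i < k, j < k)
            generic_mx R n (cyc hn (r i)) (cyc hn (c j)))).
Proof.
rewrite -det_map_mx; congr (\det _); apply/matrixP=> i j.
by rewrite !mxE /generic_entry mxE.
Qed.

Lemma generic_entry_det_neq0 (R : realFieldType) (n : nat) (hn : (0 < n)%N)
    (k : nat) (r c : 'I_k -> int) :
  injective r -> (forall i j, (`|r i - r j| < n)%N) ->
  injective c -> (forall i j, (`|c i - c j| < n)%N) ->
  \det (\matrix_(i < k, j < k) generic_entry R hn (r i) (c j)) != 0.
Proof.
move=> inj_r near_r inj_c near_c; rewrite generic_entry_det tofrac_eq0.
by apply: (@generic_det_neq0 R n k (cyc hn \o r) (cyc hn \o c)) => i j /= eq_ij;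
  [apply: inj_r | apply: inj_c]; apply: cyc_near_inj eq_ij.
Qed.

(** With [l = n.-1./2], both parities of [n] satisfy
[n - (n - 1) %% 2 = 2 * l + 1], so the central minor of index [(x, y)] has level
[l] when [x - y] is even and [l + 1] when it is odd. This leaves
[x = 2 * a + y + (d - l)], to be reduced modulo [2 * n] into [1, ..., 2 * n]; the
reduction shifts [a] and [b] by the same multiple of [n]. *)
Lemma central_contig_positive (R : realFieldType) (n : nat) (hn : (0 < n)%N)
    (a : int) (d y : nat) :
  (n.-1./2 <= d <= n.-1./2.+1)%N -> (y <= d)%N -> (y + d <= n)%N ->
  positive_rational_function_of
    (small_central_minors hn (generic_mx R n))
    (contig (generic_entry R hn) a (a + d%:Z) y).
Proof.
move=> level_d le_yd le_yn; set v := small_central_minors _ _.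
have [-> | y_gt0] := posnP y.
  by rewrite /contig det_mx00; case: (positive_rational_closed v).
pose e := (d - n.-1./2)%N.
pose x := 2 * a + y%:Z + e%:Z.
(* The representative modulo 2n lies in 1, ..., 2n rather than 0, ..., 2n-1. *)
pose x' := `|((x - 1) %% (2 * n)%:Z)%Z|.+1.
have [q def_x] : exists q, x = x'%:Z + 2 * (q * n%:Z).
  exists ((x - 1) %/ (2 * n)%:Z)%Z; have := divz_eq (x - 1) (2 * n)%:Z.
  have : (0 <= (x - 1) %% (2 * n)%:Z)%Z by apply: modz_ge0; lia.
  rewrite /x'; nia.
have lt_x' : (x' < (2 * n).+1)%N.
  have := @ltz_pmod (x - 1) (2 * n)%:Z; rewrite /x'.
  have : (0 <= (x - 1) %% (2 * n)%:Z)%Z by apply: modz_ge0; lia.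
  lia.
have lt_y : (y < n.+1)%N by lia.
pose xy := (Ordinal lt_x', Ordinal lt_y).
have small_xy : xy \in small_idx n.
  rewrite inE /= y_gt0; apply/orP.
  have [lt_2y | ge_2y] := ltnP (2 * y) n; [by left | right].
  move: def_x; rewrite /x /e; lia.
suff -> : contig (generic_entry R hn) a (a + d%:Z) y =
          tofrac (tnth v (enum_rank_in small_xy xy)) by exact: positive_rational_var.
rewrite tnth_mktuple enum_rankK_in // /contig generic_entry_det /= -/x'.
congr (tofrac (\det _)); apply/matrixP=> i j; rewrite !mxE.
have def_a : ((x'%:Z - y%:Z) %/ 2)%Z = a + (- q) * n%:Z.
  move: def_x; rewrite /x /e; set t := q * _; rewrite mulNr -/t; lia.
have def_b : ((x'%:Z - y%:Z + n%:Z - ((n - 1) %% 2)%N%:Z) %/ 2)%Z =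
             a + d%:Z + (- q) * n%:Z.
  move: def_x; rewrite /x /e; set t := q * _; rewrite mulNr -/t; lia.
rewrite def_a def_b; congr ('X_(mxvec_index _ _));
  rewrite -(cyc_periodic hn _ (- q)).
  by congr cyc; ring.
by congr cyc; ring.
Qed.

(** * Unrolling the cyclic order *)

(** Adding [n] to the entries that the rotation moves to the front makes the list
increasing without changing residues. The last property says that it still goes
around the cycle less than once. *)
Lemma unroll_cyclic (n : nat) (s : seq nat) (r : nat) :
  all (gtn n) s -> sorted ltn (rot r s) ->
  exists u, [/\ size u = size s, sorted ltn u,
    forall i, (i < size s)%N -> nth 0%N u i = nth 0%N s i %[mod n]
  & forall x y, x \in u -> y \in u -> (x < y + n)%N].
Proof.
move=> lt_sn sorted_s; exists (take r s ++ map (addn n) (drop r s)).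
have lt_n x : x \in s -> (x < n)%N by move/(allP lt_sn).
have in_take x : x \in take r s -> (x < n)%N by move/mem_take/lt_n.
have in_drop x : x \in drop r s -> (x < n)%N by move/mem_drop/lt_n.
move: sorted_s; rewrite /rot !(sorted_pairwise ltn_trans) !pairwise_cat.
case/and3P=> /allrelP drop_take pw_drop pw_take; split.
- by rewrite size_cat size_map -size_cat cat_take_drop.
- apply/and3P; split=> //; last first.
    rewrite pairwise_map; apply: sub_pairwise pw_drop => x y /=.
    by rewrite ltn_add2l.
  apply/allrelP=> x _ /in_take lt_x /mapP[y _ ->].
  by rewrite (leq_trans lt_x) // leq_addr.
- move=> i lt_i; rewrite -[s in RHS](cat_take_drop r) !nth_cat.
  case: ltnP => // ge_i.
  have [lt_id | ge_id] := ltnP (i - size (take r s)) (size (drop r s)).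
    by rewrite (nth_map 0%N) // modnDl.
  by rewrite !nth_default ?size_map.
- move=> x y; rewrite !mem_cat.
  move=> /orP[xt | /mapP[x' xd ->]] /orP[yt | /mapP[y' yd ->]].
  + by rewrite (leq_trans (in_take _ xt)) // leq_addl.
  + by rewrite -addnA (leq_trans (in_take _ xt)) // leq_addr.
  + by rewrite addnC ltn_add2r; apply: drop_take.
  + by have := in_drop _ xd; lia.
Qed.

Theorem theorem4p5 (R : realFieldType) (n : nat) (hn : (0 < n)%N)
    (A B : {set 'I_n}) (k : nat) (a b : k.-tuple 'I_n)
    (hAB : noninterlaced A B)
    (hkA : #|A| = k) (hkB : #|B| = k)
    (hA : A = [set i in a]) (hB : B = [set i in b])
    (hord : cyclically_ordered (a ++ rev b)) :
  positive_rational_function_of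
    (small_central_minors hn (generic_mx R n))
    (tofrac (minor (generic_mx R n) a b)).
Proof.
have closedP := positive_rational_closed (small_central_minors hn (generic_mx R n)).
case: k => [|k] in a b hkA hkB hA hB hord *.
  by rewrite /minor det_mx00 tofrac1; case: closedP.
pose s := map val (a ++ rev b).
have size_s : size s = (k.+1 + k.+1)%N.
  by rewrite size_map size_cat size_rev !size_tuple.
case: hord => r; rewrite -/s => sorted_s.
have lt_sn : all (gtn n) s by apply/allP=> _ /mapP[i _ ->]; exact: ltn_ord.
have [u [size_u sorted_u u_mod near_u]] := unroll_cyclic lt_sn sorted_s.
rewrite size_s in size_u u_mod.
pose w := nth 0%N u.
have w_mono i j : (i < j)%N -> (j < k.+1 + k.+1)%N -> (w i < w j)%N.
  move=> lt_ij lt_j; rewrite (sorted_ltn_nth ltn_trans) ?inE ?size_u //.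
  exact: ltn_trans lt_j.
have near_w i j : (i < k.+1 + k.+1)%N -> (j < k.+1 + k.+1)%N -> (w i < w j + n)%N.
  by move=> lt_i lt_j; apply: near_u; rewrite mem_nth ?size_u.
have w_mod (i : nat) (x : 'I_n) : (i < k.+1 + k.+1)%N ->
    nth 0%N s i = x -> cyc hn (w i)%:Z = x.
  move=> lt_i s_i; apply: cyc_nat; rewrite -s_i; exact: u_mod.
have w_row (i : 'I_k.+1) : cyc hn (w i)%:Z = tnth a i.
  apply: w_mod; first by have := ltn_ord i; lia.
  rewrite (nth_map (tnth a i)) ?size_cat ?size_rev ?size_tuple; last first.
    by have := ltn_ord i; lia.
  by rewrite nth_cat size_tuple ltn_ord -tnth_nth.
have w_col (j : 'I_k.+1) : cyc hn (w (k.+1 + (k - j))%N)%:Z = tnth b j.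
  have lt_j := ltn_ord j.
  apply: w_mod; first by lia.
  rewrite (nth_map (tnth b j)) ?size_cat ?size_rev ?size_tuple; last by lia.
  rewrite nth_cat size_tuple ltnNge leq_addr addKn nth_rev size_tuple; last by lia.
  by rewrite subSS subKn // -tnth_nth.
clearbody w.
(* The rows are counted up from w 0, the columns down from w 0 + n - 1. *)
pose p := (w k - w 0 + 1)%N.
pose last : int := (w 0 + n)%N%:Z - 1.
pose f i := (w i - w 0)%N.
pose g j := (w 0 + n - 1 - w (k.+1 + (k - j))%N)%N.
pose M i j := generic_entry R hn ((w 0)%:Z + i%:Z) (last - j%:Z).
have w0_le i : (i < k.+1 + k.+1)%N -> (w 0 <= w i)%N.
  by case: i => // i lt_i; apply/ltnW/w_mono.
have inc_f : increasing_into k.+1 p f.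
  split=> [i j|i]; rewrite ?inE => lt_i.
    by move=> lt_j lt_ij; have := w_mono i j lt_ij; have := w0_le i; rewrite /f; lia.
  have le_ik : (w i <= w k)%N.
    by move: lt_i; rewrite ltnS leq_eqVlt => /predU1P[-> // | /w_mono]; lia.
  by rewrite /f /p; lia.
have inc_g : increasing_into k.+1 (n - p) g.
  split=> [i j|i]; rewrite ?inE => lt_i.
    move=> lt_j lt_ij; rewrite /g.
    have := w_mono (k.+1 + (k - j))%N (k.+1 + (k - i))%N.
    by have := near_w (k.+1 + (k - i))%N 0%N; lia.
  have := w_mono k (k.+1 + (k - i))%N; have := near_w (k.+1 + (k - i))%N 0%N.
  by have := w0_le k; rewrite /g /p; lia.
have le_pn : (p <= n)%N.
  by have := near_w k 0%N; have := w0_le k; rewrite /p; lia.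
have -> : tofrac (minor (generic_mx R n) a b) = table_minor M k.+1 f g.
  rewrite /table_minor generic_entry_det; congr (tofrac (\det _)).
  apply/matrixP=> i j; rewrite !mxE -w_row -w_col.
  congr ('X_(mxvec_index (cyc _ _) (cyc _ _))).
    by rewrite -PoszD subnKC ?w0_le // ltn_addr.
  have lt_j := ltn_ord j; have := near_w (k.+1 + (k - j))%N 0%N.
  by rewrite /last /g; lia.
apply: (minors_of_solid_minors closedP) inc_f inc_g =>
  [m f1 g1 inc1 inc2 | m i j le_ip le_jq].
  have [_ lt_f1] := inc1; have [_ lt_g1] := inc2.
  apply: generic_entry_det_neq0 => x y.
  - by move=> eq_xy; apply: increasing_into_inj inc1 _; lia.
  - by have := lt_f1 x (ltn_ord x); have := lt_f1 y (ltn_ord y); lia.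
  - by move=> eq_xy; apply: increasing_into_inj inc2 _; lia.
  - by have := lt_g1 x (ltn_ord x); have := lt_g1 y (ltn_ord y); lia.
have -> : table_minor M m (addn i) (addn j) =
    contig (generic_entry R hn) ((w 0)%:Z + i%:Z)
      ((w 0)%:Z + i%:Z + (n - i - j - m)%N%:Z) m.
  congr (\det _); apply/matrixP=> x y; rewrite !mxE /M /last.
  congr (generic_entry _ _ _ _); first by lia.
  have -> : (n - i - j - m)%N%:Z = n%:Z - i%:Z - j%:Z - m%:Z by lia.
  by rewrite !PoszD; ring.
apply: (@contig_minors_of_central _ _ _ n n.-1./2) => //; try lia.
- move=> a0 b0 y le_yn; apply: generic_entry_det_neq0 => [x z|x z|x z|x z];
    have := ltn_ord x; have := ltn_ord z; try lia.
  + by move=> _ _ eq_xz; apply: val_inj => /=; lia.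
  + by move=> _ _ eq_xz; apply: val_inj => /=; lia.
- exact: central_contig_positive.
Qed.
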